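(* Let $(X,d)$ be a metric space, let $k\ge 1$ and $p_1,p_2,\ldots,p_k\in X$, and let $D=X\setminus\{p_1,p_2,\ldots,p_k\}$. Then for all $x,y\in D$, $$\hat{\tau}_D(x,y)\le 2\,\tilde{j}_D(x,y).$$ Moreover, the inequality is sharp for $D=\mathbb{R}^n\setminus\{-e_1,e_1\}$ (that is, $X=\mathbb{R}^n$ with the Euclidean metric, $n\ge 2$, $k=2$, $\{p_1,p_2\}=\{-e_1,e_1\}$, $e_1=(1,0,\ldots,0)$): the constant $2$ cannot be replaced by any smaller constant.
   Context: For a metric space $(X,d)$, points $p_1,\ldots,p_k\in X$ and $D=X\setminus\{p_1,\ldots,p_k\}$, write $d(x)=\min_{1\le i\le k}d(x,p_i)$ for $x\in D$ (the distance from $x$ to the boundary of $D$). The average scale-invariant Cassinian metric of $D$ is $$\hat{\tau}_D(x,y)=\frac1k\sum_{i=1}^k\log\left(1+2\frac{d(x,y)}{\sqrt{d(x,p_i)\,d(y,p_i)}}\right),\quad x,y\in D.$$ The distance ratio metric $\tilde{j}_D$ is $$\tilde{j}_D(x,y)=\log\left(1+\frac{d(x,y)}{\min\{d(x),d(y)\}}\right),\quad x,y\in D.$$ *)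

(* Defs.v *)
From HB Require Import structures.
From mathcomp Require Import all_boot all_order all_algebra.
From mathcomp Require Import all_classical all_reals all_analysis.
From mathcomp Require Import ring lra.

Set Implicit Arguments.
Unset Strict Implicit.
Unset Printing Implicit Defensive.

Import Order.TTheory GRing.Theory Num.Theory.

Local Open Scope classical_set_scope.
Local Open Scope ring_scope.

Section punctured_metric_space.
Context {R : realType} {X : metricType R} {k : nat}.
(* At least one point is removed; repetitions among the [p i] are allowed. *)
Variable p : 'I_k.+1 -> X.
Implicit Types x y : X.

Definition punctured : set X := ~` range p.

(* The initial value of the iterated minimum is itself one of its terms. *)
Definition bdist x : R :=
  \big[Num.min/mdist x (p ord0)]_(i < k.+1) mdist x (p i).

Definition avg_cassinian x y : R :=
  k.+1%:R^-1 * \sum_(i < k.+1)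
    ln (1 + 2 * (mdist x y / Num.sqrt (mdist x (p i) * mdist y (p i)))).

Definition dist_ratio x y : R :=
  ln (1 + mdist x y / Num.min (bdist x) (bdist y)).

End punctured_metric_space.

(* R^n with the Euclidean metric: the library equips ['rV[R]_n] with the
   sup-norm metric, whence an alias carrying its own metric structure. *)
Definition euclidean (R : realType) (n : nat) : Type := 'rV[R]_n.

HB.instance Definition _ (R : realType) (n : nat) :=
  Choice.on (euclidean R n).

Section euclidean_metric.
Context {R : realType} {n : nat}.
Implicit Types x y z : euclidean R n.

Definition euclidean_dist x y : R :=
  Num.sqrt (\sum_(i < n) ((x : 'rV[R]_n) 0 i - (y : 'rV[R]_n) 0 i) ^+ 2).

Lemma euclidean_distxx x : euclidean_dist x x = 0.
Proof.
rewrite /euclidean_dist big1 ?sqrtr0// => i _.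
by rewrite subrr expr0n.
Qed.

Lemma euclidean_dist_eq0 x y : euclidean_dist x y = 0 -> x = y.
Proof.
move=> /eqP; rewrite sqrtr_eq0 => le0.
have s0 : \sum_(i < n) ((x : 'rV[R]_n) 0 i - (y : 'rV[R]_n) 0 i) ^+ 2 = 0.
  by apply/eqP; rewrite eq_le le0 sumr_ge0// => i _; exact: sqr_ge0.
apply/rowP => i.
apply/eqP; rewrite -subr_eq0 -sqrf_eq0; apply/eqP.
by apply: (psumr_eq0P _ s0) => // j _; exact: sqr_ge0.
Qed.

Lemma euclidean_dist_sym x y : euclidean_dist x y = euclidean_dist y x.
Proof.
by rewrite /euclidean_dist; congr Num.sqrt; apply: eq_bigr => i _; ring.
Qed.

Lemma sum_cauchy_schwarz (u v : 'I_n -> R) :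
  (\sum_i u i * v i) ^+ 2 <= (\sum_i u i ^+ 2) * (\sum_i v i ^+ 2).
Proof.
set A := \sum_i u i ^+ 2; set B := \sum_i v i ^+ 2.
set C := \sum_i u i * v i.
have B0 : 0 <= B by apply: sumr_ge0 => i _; exact: sqr_ge0.
have [B_eq0|B_neq0] := eqVneq B 0.
  have v0 i : v i = 0.
    apply/eqP; rewrite -sqrf_eq0; apply/eqP.
    by apply: (psumr_eq0P _ B_eq0) => // j _; exact: sqr_ge0.
  by rewrite B_eq0 /C big1 ?expr0n ?mulr0// => i _; rewrite v0 mulr0.
have : 0 <= \sum_i (B * u i - C * v i) ^+ 2.
  by apply: sumr_ge0 => i _; exact: sqr_ge0.
have -> : \sum_i (B * u i - C * v i) ^+ 2 = B * (A * B - C ^+ 2).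
  rewrite (eq_bigr (fun i => B ^+ 2 * u i ^+ 2 + (- (2 * B * C)) * (u i * v i)
     + C ^+ 2 * v i ^+ 2)) => [|i _]; last by ring.
  by rewrite !big_split/= -!mulr_sumr -/A -/B -/C; ring.
by rewrite pmulr_rge0 ?subr_ge0// lt_def B_neq0.
Qed.

Lemma euclidean_dist_triangle y x z :
  euclidean_dist x z <= euclidean_dist x y + euclidean_dist y z.
Proof.
pose u i := (x : 'rV[R]_n) 0 i - (y : 'rV[R]_n) 0 i.
pose v i := (y : 'rV[R]_n) 0 i - (z : 'rV[R]_n) 0 i.
have A0 : 0 <= \sum_i u i ^+ 2 by apply: sumr_ge0 => i _; exact: sqr_ge0.
have B0 : 0 <= \sum_i v i ^+ 2 by apply: sumr_ge0 => i _; exact: sqr_ge0.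
have uv0 : 0 <= euclidean_dist x y + euclidean_dist y z.
  by rewrite addr_ge0// sqrtr_ge0.
rewrite -(ger0_norm uv0) -sqrtr_sqr ler_wsqrtr// sqrrD !sqr_sqrtr//.
rewrite (eq_bigr (fun i => u i ^+ 2 + 2 * (u i * v i) + v i ^+ 2)); last first.
  by move=> i _; rewrite /u /v; ring.
rewrite !big_split/= -mulr_sumr lerD2r lerD2l mulr_natl lerMn2r/=.
rewrite (le_trans (ler_norm _))// -sqrtr_sqr -sqrtrM// ler_wsqrtr//.
exact: sum_cauchy_schwarz.
Qed.

HB.instance Definition _ := @isMetric.Build R (euclidean R n) euclidean_dist
  euclidean_distxx euclidean_dist_eq0 euclidean_dist_sym
  euclidean_dist_triangle.

End euclidean_metric.

Definition e1 {R : realType} {n : nat} : 'rV[R]_n :=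
  \row_(j < n) (val j == 0%N)%:R.

Definition pm_e1 {R : realType} {n : nat} (i : 'I_2) : euclidean R n :=
  if i == ord0 then - e1 else e1.

(* Main.v *)
Require Import Defs.
From mathcomp Require Import all_boot all_order all_algebra.
From mathcomp Require Import all_classical all_reals all_analysis.
From mathcomp Require Import ring lra.

Import Order.TTheory GRing.Theory Num.Theory.

Local Open Scope classical_set_scope.
Local Open Scope ring_scope.

(** If [m] is the smaller of the two boundary distances, then
    [sqrt (d(x,p_i) d(y,p_i)) >= m], and [1 + 2t <= (1 + t)^2] at [t = d(x,y)/m]
    bounds every term of the average by [2 log (1 + d(x,y)/m)].  For sharpness,
    compare the two sides to first order at the origin and [s e_2] as [s]
    tends to [0]: there both boundary points are at distance [1] and
    [sqrt (1 + s^2)] respectively. *)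

Section punctured_metric_space.
Context {R : realType} {X : metricType R} {k : nat} (p : 'I_k.+1 -> X).
Implicit Types x y : X.

Lemma bdist_le x i : bdist p x <= mdist x (p i).
Proof. exact: bigmin_le. Qed.

Lemma bdist_gt0 x : punctured p x -> 0 < bdist p x.
Proof.
move=> px; have d0 i : 0 < mdist x (p i).
  by rewrite mdist_gt0; apply: contra_notN px => /eqP ->; exists i.
(* The initial value of the iterated minimum is one of these distances too, so it is positive as
   well. *)
by rewrite /bdist; apply: lt_bigmin.
Qed.

Lemma avg_cassinian_le_dist_ratio x y : punctured p x -> punctured p y ->
  avg_cassinian p x y <= 2 * dist_ratio p x y.
Proof.
move=> px py; rewrite /avg_cassinian /dist_ratio.
set m := Num.min _ _.
have m0 : 0 < m by rewrite /m lt_min !bdist_gt0.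
have t0 : 0 <= mdist x y / m by rewrite divr_ge0 ?mdist_ge0// ltW.
have m_le i : m <= Num.sqrt (mdist x (p i) * mdist y (p i)).
  rewrite -(gtr0_norm m0) -sqrtr_sqr ler_wsqrtr// expr2 (ler_pM (ltW m0) (ltW m0))//.
    by rewrite (le_trans _ (bdist_le x i))// /m ge_min lexx.
  by rewrite (le_trans _ (bdist_le y i))// /m ge_min lexx orbT.
(* After clearing the factor [k.+1], the right side becomes a sum of [k.+1] equal terms, so the
   comparison can be made term by term. *)
rewrite mulrC ler_pdivrMr ?ltr0n// mulr_natr.
rewrite -[X in _ <= _ *+ X](card_ord k.+1) -sumr_const ler_sum// => i _.
rewrite [leRHS]mulr_natl -lnXn; last by rewrite ltr_wpDr.
have u_le : mdist x y / Num.sqrt (mdist x (p i) * mdist y (p i)) <= mdist x y / m.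
  by rewrite ler_wpM2l ?mdist_ge0// lef_pV2 ?posrE// (lt_le_trans m0).
have u0 : 0 <= mdist x y / Num.sqrt (mdist x (p i) * mdist y (p i)).
  by rewrite divr_ge0 ?mdist_ge0 ?sqrtr_ge0.
(* With [u <= t] for the two quotients, [1 + 2u <= 1 + 2t <= (1 + t)^2]. *)
by rewrite ler_ln ?posrE; nra.
Qed.

End punctured_metric_space.

(** Apply [ln (1 + v) <= v] to [1 + v = 1 / (1 + u)] and change signs. This bounds the Cassinian
    side from below in the sharpness argument. *)
Lemma ln1D_ge (R : realType) (u : R) : 0 <= u -> u / (1 + u) <= ln (1 + u).
Proof.
move=> u0; have u1 : 0 < 1 + u by rewrite ltr_wpDr.
have -> : u / (1 + u) = - ((1 + u)^-1 - 1) by field; rewrite gt_eqF.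
rewrite lerNl -lnV ?posrE// -[X in ln X](subrKC 1) le_ln1Dx//.
by have := @invr_gt0 R (1 + u); rewrite u1; lra.
Qed.

Lemma sqrt_1Dsqr_ge1 (R : rcfType) (s : R) : 1 <= Num.sqrt (1 + s ^+ 2).
Proof. by rewrite -[leLHS]sqrtr1 ler_wsqrtr// lerDl sqr_ge0. Qed.

Lemma sqrt_1Dsqr_le (R : rcfType) (s : R) : 0 <= s -> Num.sqrt (1 + s ^+ 2) <= 1 + s.
Proof.
move=> s0; have s1 : 0 <= 1 + s by rewrite addr_ge0.
by rewrite -[leRHS](ger0_norm s1) -sqrtr_sqr ler_wsqrtr//; nra.
Qed.

Section sharpness.
Context {R : realType} {m : nat}.

Definition origin : euclidean R m.+2 := (0 : 'rV[R]_m.+2).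

(** The point [s e_2]: columns are counted from 0, and dimension [m.+2] ensures that column 1
    exists. Being orthogonal to [e_1], it is equidistant from both punctures. *)
Definition scaled_e2 (s : R) : euclidean R m.+2 :=
  \row_(j < m.+2) (s *+ (val j == 1%N)).

Lemma mdist_origin_scaled_e2 s : 0 <= s -> mdist origin (scaled_e2 s) = s.
Proof.
move=> s0; rewrite -[LHS]/(euclidean_dist _ _) /euclidean_dist.
rewrite 2!big_ord_recl big1 => [|i _]; rewrite !mxE/=; last by rewrite subrr expr0n.
by rewrite -[RHS](ger0_norm s0) -sqrtr_sqr; congr Num.sqrt; ring.
Qed.

Lemma mdist_scaled_e2_pm_e1 s (i : 'I_2) :
  mdist (scaled_e2 s) (pm_e1 i) = Num.sqrt (1 + s ^+ 2).
Proof.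
rewrite -[LHS]/(euclidean_dist _ _) /euclidean_dist /pm_e1.
rewrite 2!big_ord_recl big1 => [|j _].
  by case: ifP => _; rewrite !mxE/=; congr Num.sqrt; ring.
by case: ifP => _; rewrite !mxE/=; ring.
Qed.

Lemma scaled_e2_0 : scaled_e2 0 = origin.
Proof. by apply/rowP => j; rewrite !mxE mul0rn. Qed.

Lemma mdist_origin_pm_e1 (i : 'I_2) : mdist origin (pm_e1 i) = 1.
Proof. by rewrite -scaled_e2_0 mdist_scaled_e2_pm_e1 expr0n addr0 sqrtr1. Qed.

Lemma punctured_scaled_e2 s : punctured pm_e1 (scaled_e2 s).
Proof.
move=> [i _ ei]; have := mdist_scaled_e2_pm_e1 s i.
rewrite ei mdistxx => /esym/eqP; rewrite gt_eqF// sqrtr_gt0.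
by rewrite ltr_pwDl// sqr_ge0.
Qed.

Lemma bdist_scaled_e2 s : bdist pm_e1 (scaled_e2 s) = Num.sqrt (1 + s ^+ 2).
Proof.
rewrite /bdist mdist_scaled_e2_pm_e1 2!big_ord_recl big_ord0.
by rewrite !mdist_scaled_e2_pm_e1 !minxx.
Qed.

Lemma dist_ratio_origin_scaled_e2 s : 0 <= s ->
  dist_ratio pm_e1 origin (scaled_e2 s) = ln (1 + s).
Proof.
move=> s0; rewrite /dist_ratio mdist_origin_scaled_e2//.
rewrite -scaled_e2_0 !bdist_scaled_e2 expr0n addr0 sqrtr1.
by rewrite min_l ?sqrt_1Dsqr_ge1// divr1.
Qed.

(** By equidistance the two terms of the average coincide. The inner root is the distance from
    [s e_2] to a puncture, the outer one the geometric mean with the distance 1 from the origin. *)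
Lemma avg_cassinian_origin_scaled_e2 s : 0 <= s ->
  avg_cassinian pm_e1 origin (scaled_e2 s) =
  ln (1 + 2 * (s / Num.sqrt (Num.sqrt (1 + s ^+ 2)))).
Proof.
move=> s0; rewrite /avg_cassinian mdist_origin_scaled_e2//.
rewrite 2!big_ord_recl big_ord0 !mdist_origin_pm_e1 !mdist_scaled_e2_pm_e1 mul1r.
by field.
Qed.

Lemma dist_ratio_constant_ge2 (c : R) :
  (forall x y : euclidean R m.+2, punctured pm_e1 x -> punctured pm_e1 y ->
     avg_cassinian pm_e1 x y <= c * dist_ratio pm_e1 x y) ->
  2 <= c.
Proof.
move=> H; rewrite leNgt; apply/negP => c2.
have first_order (s : R) : 0 < s -> 2 <= c * (1 + 3 * s) /\ 0 <= c.
  move=> s0; have s0' := ltW s0.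
  have := H _ _ (punctured_scaled_e2 0) (punctured_scaled_e2 s).
  rewrite scaled_e2_0 avg_cassinian_origin_scaled_e2//.
  rewrite dist_ratio_origin_scaled_e2//.
  set q := Num.sqrt (Num.sqrt _) => cassinian_le.
  have q1 : 1 <= q by rewrite -[leLHS]sqrtr1 ler_wsqrtr ?sqrt_1Dsqr_ge1.
  (* Since [q >= 1], [q <= q^2 = sqrt (1 + s^2) <= 1 + s]. *)
  have qs : q <= 1 + s.
    apply: le_trans (sqrt_1Dsqr_le _ _ s0').
    rewrite -[leRHS](sqr_sqrtr (sqrtr_ge0 _)) -/q.
    by rewrite expr2 ler_peMr// (le_trans _ q1).
  have u0 : 0 <= 2 * (s / q) by rewrite mulr_ge0// divr_ge0//; lra.
  have := ln1D_ge _ _ u0.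
  have -> : 2 * (s / q) / (1 + 2 * (s / q)) = 2 * s / (q + 2 * s).
    by field; apply/andP; split; rewrite gt_eqF//; lra.
  move=> /le_trans/(_ cassinian_le).
  rewrite ler_pdivrMr; last lra.
  move=> main.
  have l0 : 0 <= ln (1 + s) by rewrite ln_ge0// lerDl.
  have ls : ln (1 + s) <= s by rewrite le_ln1Dx//; lra.
  (* A negative [c] would make the right side of [main] nonpositive, while its left side is
     [2 s > 0]. *)
  have c0 : 0 <= c.
    rewrite leNgt; apply/negP => cn.
    have cl0 : c * ln (1 + s) <= 0 by rewrite mulr_le0_ge0// ltW.
    have : c * ln (1 + s) * (q + 2 * s) <= 0 by rewrite mulr_le0_ge0//; lra.
    by lra.
  (* In [main], use [ln (1 + s) <= s] and [q + 2 s <= 1 + 3 s], then cancel [s]. *)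
  split=> //; rewrite -(ler_pM2r s0) (le_trans main)//.
  apply: (@le_trans _ _ (c * s * (1 + 3 * s))); last by rewrite mulrAC.
  by rewrite ler_pM// ?mulr_ge0 ?ler_wpM2l//; lra.
(* For this [s], [c (1 + 3 s) = 2 - (2 - c)^2 / 2 < 2], a contradiction. *)
have s0 : 0 < (2 - c) / 6 by lra.
by have [] := first_order _ s0; nra.
Qed.

End sharpness.

Theorem theorem3p4 (R : realType) :
  (forall (X : metricType R) (k : nat) (p : 'I_k.+1 -> X) (x y : X),
     punctured p x -> punctured p y ->
     avg_cassinian p x y <= 2 * dist_ratio p x y) /\
  (forall n : nat, (2 <= n)%N ->
     forall c : R, c < 2 ->
       ~ (forall x y : euclidean R n,
            punctured pm_e1 x -> punctured pm_e1 y ->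
            avg_cassinian pm_e1 x y <= c * dist_ratio pm_e1 x y)).
Proof.
split=> [X k p x y|[|[|m]]// _ c c2 H]; first exact: avg_cassinian_le_dist_ratio.
by have := dist_ratio_constant_ge2 _ H; rewrite leNgt c2.
Qed.
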